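(* Let $G$ be an $(X,Y)$-bipartite graph with $|X|=m$ and $|Y|=n$. If $\delta(X,Y) > \frac{2}{3} n$ and $\delta(Y,X) > \frac{2}{3} m$, then in every 2-edge coloring of $G$ there exists a monochromatic component on at least $\frac{m+n}{2}$ vertices.
   Context: For an $(X,Y)$-bipartite graph $G$, $\delta(X,Y)$ denotes the minimum degree of a vertex of $X$ (into $Y$), and $\delta(Y,X)$ the minimum degree of a vertex of $Y$ (into $X$). In an edge-colored graph, a monochromatic component is a connected component of the subgraph formed by the edges of a single color. *)

(* Defs.v *)
From mathcomp Require Import all_boot all_order all_algebra.

Set Implicit Arguments.
Unset Strict Implicit.
Unset Printing Implicit Defensive.

Definition simple_graph (T : finType) (e : rel T) : Prop :=
  symmetric e /\ irreflexive e.

Definition bipartition (T : finType) (e : rel T) (X Y : {set T}) : Prop :=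
  [/\ X :|: Y = [set: T],
      [disjoint X & Y] &
      forall u v, e u v ->
        (u \in X) && (v \in Y) || (u \in Y) && (v \in X)].

Definition degree_in (T : finType) (e : rel T) (B : {set T}) (x : T) : nat :=
  #|[set y in B | e x y]|.

(* Every degree into B is at most #|B|, so the neutral element #|B| only
   matters when A is empty. *)
Definition min_degree (T : finType) (e : rel T) (A B : {set T}) : nat :=
  \big[minn/#|B|]_(x in A) degree_in e B x.

(* A coloring assigns a color to the unordered pair [set u; v]; its values on
   sets that are not edges are never used. *)
Definition color_rel (T : finType) (e : rel T) (k : nat)
    (c : {set T} -> 'I_k) (i : 'I_k) : rel T :=
  [rel u v | e u v && (c [set u; v] == i)].

Definition color_support (T : finType) (e : rel T) (k : nat)
    (c : {set T} -> 'I_k) (i : 'I_k) : {set T} :=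
  [set u | [exists v, color_rel e c i u v]].

(* The subgraph formed by the edges of color i has as vertices only the
   endpoints of those edges, so isolated vertices are not components. *)
Definition mono_components (T : finType) (e : rel T) (k : nat)
    (c : {set T} -> 'I_k) (i : 'I_k) : {set {set T}} :=
  equivalence_partition (connect (color_rel e c i)) (color_support e c i).

(* Main.v *)
Require Import Defs.
From mathcomp Require Import all_boot all_order all_algebra zify lra.

Import Order.TTheory GRing.Theory Num.Theory.

Set Implicit Arguments.
Unset Strict Implicit.
Unset Printing Implicit Defensive.

(** Place every vertex in the cell (red component, blue component) of a grid
    whose rows are the red and whose columns are the blue components.  Adjacent
    vertices share a line, so the cross through a vertex of one side contains
    more than two thirds of the other side.  No vertex lies on the crosses of
    three vertices in general position, whereas three sets of density more than
    two thirds would have total density more than two; hence each side has no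
    such triple and is covered by two lines, as in König's theorem.  If no line
    contains half of all the vertices, then no line contains more than two
    thirds of one side.  This rules out a cover of a side by two parallel lines,
    and if each side is covered by a row and a column, then these four lines are
    distinct and one side has two vertices whose crosses are disjoint within the
    other side. *)

Section CardinalityInSubsets.

Variables (T : finType) (B : {set T}).
Implicit Types P Q R : {set T}.

Lemma leq_card_setI2 P Q :
  #|B :&: P| + #|B :&: Q| <= #|B| + #|B :&: (P :&: Q)|.
Proof.
by rewrite -cardsUI -setIUr -setIIr leq_add2r subset_leq_card ?subsetIl.
Qed.

Lemma leq_card_setI3 P Q R : P :&: Q :&: R = set0 ->
  #|B :&: P| + #|B :&: Q| + #|B :&: R| <= 2 * #|B|.
Proof.
move=> PQR0; have := leq_card_setI2 (P :&: Q) R; rewrite PQR0 setI0 cards0.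
by have := leq_card_setI2 P Q; lia.
Qed.

Lemma leq_card_cover P Q :
  B \subset P :|: Q -> #|B| <= #|B :&: P| + #|B :&: Q|.
Proof. by move/setIidPl=> {1}<-; rewrite setIUr leq_card_setU. Qed.

End CardinalityInSubsets.

Definition line (T : finType) (I : eqType) (f : T -> I) (i : I) : {set T} :=
  [set x | f x == i].

Definition small_lines (T : finType) (I : eqType) (f : T -> I)
    (A B : {set T}) : Prop :=
  forall i, 2 * (#|A :&: line f i| + #|B :&: line f i|) < #|A| + #|B|.

Section Crosses.

Variables (T : finType) (I J : eqType) (r : T -> I) (b : T -> J).
Implicit Types A B : {set T}.

Definition cross (x : T) : {set T} := line r (r x) :|: line b (b x).

Definition pairwise_aligned A : bool := [forall x in A, A \subset cross x].

Definition general_position (x y z : T) : bool :=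
  [&& y \notin cross x, z \notin cross x & z \notin cross y].

Definition general_position_free A : Prop :=
  {in A & &, forall x y z, ~~ general_position x y z}.

Definition dense_crosses A B : Prop :=
  {in A, forall x, 2 * #|B| < 3 * #|B :&: cross x|}.

End Crosses.

Lemma small_linesC (T : finType) (I : eqType) (f : T -> I) (A B : {set T}) :
  small_lines f A B -> small_lines f B A.
Proof. by move=> small_f i; have := small_f i; lia. Qed.

Lemma dense_crossesC (T : finType) (I J : eqType) (r : T -> I) (b : T -> J)
    (A B : {set T}) :
  dense_crosses r b A B -> dense_crosses b r A B.
Proof. by move=> dense x /dense; rewrite /cross setUC. Qed.

Section TwoLineCover.

Variables (T : finType) (I J : eqType) (r : T -> I) (b : T -> J).
Implicit Types A B : {set T}.

Lemma general_position_crossI x y z : general_position r b x y z ->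
  cross r b x :&: cross r b y :&: cross r b z = set0.
Proof.
move=> gp; apply/setP=> w; rewrite !inE; apply: contraTF gp.
move=> /andP[/andP[/orP[]/eqP wx /orP[]/eqP wy] /orP[]/eqP wz];
  by rewrite /general_position !inE -?wx -?wy -?wz eqxx ?orbT ?andbF.
Qed.

Lemma dense_crosses_general_position_free A B :
  dense_crosses r b A B -> general_position_free r b A.
Proof.
move=> dAB x y z xA yA zA; apply/negP => /general_position_crossI disj.
by have := leq_card_setI3 B disj; move: (dAB x xA) (dAB y yA) (dAB z zA); lia.
Qed.

Lemma pairwise_aligned_line (x0 : T) A : pairwise_aligned r b A ->
  (exists u, A \subset line r u) \/ (exists v, A \subset line b v).
Proof.
move=> /forall_inP aligned.
have [->|[x xA]] := set_0Vmem A; first by left; exists (r x0); rewrite sub0set.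
have [row|/subsetPn[y yA]] := boolP (A \subset line r (r x)).
  by left; exists (r x).
have := subsetP (aligned x xA) y yA.
rewrite !inE => /orP[->//|/eqP byx] ryx.
right; exists (b x); apply/subsetP => z zA; rewrite inE.
have := subsetP (aligned y yA) z zA; have := subsetP (aligned x xA) z zA.
rewrite !inE byx => /orP[/eqP -> /orP[|//]|//].
by rewrite eq_sym (negPf ryx).
Qed.

(* Otherwise let p, q be unaligned off the row of x and z, w unaligned off its
   column: up to exchanging names p is in the column of x, z in the row of x
   and w in the row of p.  As z and w lie in different columns, q, x, w or
   p, q, z is in general position. *)
Lemma pairwise_aligned_off_line A x : x \in A ->
  general_position_free r b A ->
  pairwise_aligned r b (A :\: line r (r x)) \/
  pairwise_aligned r b (A :\: line b (b x)).
Proof.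
move=> xA gp_free.
have [|/forall_inPn[p pA /subsetPn[q qA]]] :=
  boolP (pairwise_aligned r b (A :\: line r (r x))); first by left.
have [|/forall_inPn[z zA /subsetPn[w wA]]] :=
  boolP (pairwise_aligned r b (A :\: line b (b x))); first by right.
have aligned3 u v t : u \in A -> v \in A -> t \in A ->
    [|| v \in cross r b u, t \in cross r b u | t \in cross r b v].
  by move=> uA vA tA; have := gp_free u v t uA vA tA; rewrite !negb_and !negbK.
move: pA qA zA wA; rewrite !inE !negb_or.
move=> /andP[rpx pA] /andP[rqx qA] /andP[bzx zA] /andP[bwx wA].
move=> /andP[rwz bwz] /andP[rqp bqp].
wlog bp : p q pA qA rpx rqx rqp bqp / b p = b x.
  move=> by_symmetry; have := aligned3 x p q xA pA qA.
  rewrite !inE (negPf rpx) (negPf rqx) (negPf rqp) (negPf bqp) !orbF /=.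
  case/orP=> /eqP; first exact: (by_symmetry p q).
  by apply: (by_symmetry q p); rewrite // eq_sym.
wlog rz : z w zA wA bzx bwx rwz bwz / r z = r x.
  move=> by_symmetry; have := aligned3 x z w xA zA wA.
  rewrite !inE (negPf bzx) (negPf bwx) (negPf rwz) (negPf bwz) !orbF /=.
  case/orP=> /eqP; first exact: (by_symmetry z w).
  by apply: (by_symmetry w z); rewrite // eq_sym.
rewrite bp in bqp; rewrite rz in rwz.
have /eqP rw : r w == r p.
  have := aligned3 p z w pA zA wA.
  rewrite !inE bp rz (negPf bzx) (negPf bwx) (negPf rwz) (negPf bwz).
  by rewrite eq_sym (negPf rpx) !orbF.
have /eqP bw : b w == b q.
  have := aligned3 x q w xA qA wA.
  rewrite !inE rw (negPf rqx) (negPf bqp) (negPf rpx) (negPf bwx).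
  by rewrite eq_sym (negPf rqp).
have := aligned3 p q z pA qA zA.
rewrite !inE bp rz (negPf rqp) (negPf bqp) (negPf bzx).
rewrite ![r x == _]eq_sym (negPf rpx) (negPf rqx) /= -bw.
by rewrite eq_sym (negPf bwz).
Qed.

Lemma two_line_cover A : A != set0 -> general_position_free r b A ->
  [\/ exists u v, A \subset line r u :|: line r v,
      exists u v, A \subset line b u :|: line b v
    | exists u v, A \subset line r u :|: line b v].
Proof.
move=> /set0Pn[x xA] /(pairwise_aligned_off_line xA).
case=> /(pairwise_aligned_line x) [] [i]; rewrite subDset => cover.
- by apply: Or31; exists (r x), i.
- by apply: Or33; exists (r x), i.
- by apply: Or33; exists i, (b x); rewrite setUC.
- by apply: Or32; exists (b x), i.
Qed.

End TwoLineCover.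

Section SmallLines.

Variables (T : finType) (I J : eqType) (r : T -> I) (b : T -> J).
Variables A B : {set T}.
Hypothesis dense : dense_crosses r b B A.
Hypotheses (small_r : small_lines r A B) (small_b : small_lines b A B).

Lemma small_lines_leq_two_thirds j : 3 * #|A :&: line b j| <= 2 * #|A|.
Proof.
rewrite leqNgt; apply/negP=> large_j.
have /subsetPn[y yB] : ~~ (B \subset line b j).
  by apply/negP=> /setIidPl eqB; have := small_b j; rewrite eqB; lia.
rewrite inE => yj; set cell := line r (r y) :&: line b j.
have large_cell : #|A| < 3 * #|A :&: cell|.
  have sub : cross r b y :&: line b j \subset cell.
    apply/subsetP=> x; rewrite !inE => /andP[/orP[->//|/eqP->]].
    by rewrite (negPf yj).
  have := leq_card_setI2 A (cross r b y) (line b j).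
  by have := subset_leq_card (setIS A sub); have := dense yB; lia.
have coverB : B \subset line r (r y) :|: line b j.
  apply/subsetP=> z zB; apply: contraT; rewrite !inE negb_or => /andP[zy zj].
  have disj : cross r b z :&: cell = set0.
    apply/setP=> x; rewrite !inE; apply/negP=> /andP[].
    by case/orP=> /eqP-> /andP[]; rewrite ?(negPf zy) ?(negPf zj).
  have := leq_card_setI2 A (cross r b z) cell; rewrite disj setI0 cards0.
  by have := dense zB; lia.
have := subset_leq_card (setIS A (subsetIl (line r (r y)) (line b j))).
have := leq_card_cover coverB; have := small_r (r y); have := small_b j.
by rewrite -/cell; lia.
Qed.

Lemma small_lines_no_parallel_cover u v :
  ~~ (A \subset line r u :|: line r v).
Proof.
apply/negP=> coverA.
have coverB : B \subset line r u :|: line r v.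
  apply/subsetP=> y yB; apply: contraT; rewrite !inE negb_or => /andP[yu yv].
  have sub : A :&: cross r b y \subset A :&: line b (b y).
    apply/subsetP=> x; rewrite !inE => /andP[xA]; rewrite xA.
    case/orP=> // /eqP rxy; have := subsetP coverA x xA.
    by rewrite !inE rxy (negPf yu) (negPf yv).
  have := small_lines_leq_two_thirds (b y); have := dense yB.
  by have := subset_leq_card sub; lia.
have := leq_card_cover coverA; have := leq_card_cover coverB.
by have := small_r u; have := small_r v; lia.
Qed.

Lemma exists_column_point_off_rows u v u' :
  A \subset line r u :|: line b v ->
  exists x, [/\ x \in A, b x = v, r x != u & r x != u'].
Proof.
move=> coverA; have /subsetPn[x xA] := small_lines_no_parallel_cover u u'.
rewrite !inE negb_or => /andP[xu xu']; exists x; split=> //.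
by have := subsetP coverA x xA; rewrite !inE (negPf xu) => /eqP.
Qed.

End SmallLines.

Section PerpendicularCovers.

Variables (T : finType) (I J : eqType) (r : T -> I) (b : T -> J).
Variables A B : {set T}.
Hypothesis dense_AB : dense_crosses r b A B.
Hypothesis dense_BA : dense_crosses r b B A.
Hypotheses (small_r : small_lines r A B) (small_b : small_lines b A B).

Lemma exists_row_point_off_columns u v v' :
  A \subset line r u :|: line b v ->
  exists x, [/\ x \in A, r x = u, b x != v & b x != v'].
Proof.
rewrite setUC.
exact: (exists_column_point_off_rows (dense_crossesC dense_BA)).
Qed.

Lemma perpendicular_covers_distinct_rows u1 v1 u2 v2 :
  A \subset line r u1 :|: line b v1 -> B \subset line r u2 :|: line b v2 ->
  u1 != u2.
Proof.
move=> coverA coverB; apply/eqP=> eq_u; subst u2.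
have [x [xA rx _ xv2]] := exists_row_point_off_columns v2 coverA.
have sub : B :&: cross r b x \subset B :&: line r u1.
  apply/subsetP=> y; rewrite !inE rx => /andP[yB]; rewrite yB.
  case/orP=> // /eqP byx; have := subsetP coverB y yB.
  by rewrite !inE byx (negPf xv2) orbF.
have := small_lines_leq_two_thirds (dense_crossesC dense_AB)
  (small_linesC small_b) (small_linesC small_r) u1.
by have := dense_AB xA; have := subset_leq_card sub; lia.
Qed.

End PerpendicularCovers.

Section NotAllLinesSmall.

Variables (T : finType) (I J : eqType) (r : T -> I) (b : T -> J).
Variables A B : {set T}.
Hypothesis dense_AB : dense_crosses r b A B.
Hypothesis dense_BA : dense_crosses r b B A.
Hypotheses (small_r : small_lines r A B) (small_b : small_lines b A B).

(* A point x of A on the row u1 only and a point z of A on the column v1 only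
   have crosses that are disjoint within B. *)
Lemma no_perpendicular_covers u1 v1 u2 v2 :
  A \subset line r u1 :|: line b v1 ->
  ~~ (B \subset line r u2 :|: line b v2).
Proof.
move=> coverA; apply/negP=> coverB.
have nu : u1 != u2.
  exact: (perpendicular_covers_distinct_rows dense_AB dense_BA
    small_r small_b coverA coverB).
have nv : v1 != v2.
  move: coverA coverB; rewrite ![line r _ :|: _]setUC.
  exact: (perpendicular_covers_distinct_rows (dense_crossesC dense_AB)
    (dense_crossesC dense_BA) small_b small_r).
have [x [xA rx xv1 xv2]] :=
  exists_row_point_off_columns dense_BA small_r small_b v2 coverA.
have [z [zA bz zu1 zu2]] :=
  exists_column_point_off_rows dense_BA small_r small_b u2 coverA.
have disj : B :&: (cross r b x :&: cross r b z) = set0.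
  apply/setP=> y; rewrite !inE rx bz; apply/negP=> /andP[/(subsetP coverB)].
  rewrite !inE => yB /andP[/orP[]/eqP yx]; move: yB; rewrite yx.
    rewrite (negPf nu) /= => /eqP->.
    by rewrite eq_sym (negPf zu1) eq_sym (negPf nv).
  rewrite (negPf xv2) orbF => /eqP->.
  by rewrite eq_sym (negPf zu2) (negPf xv1).
have := leq_card_setI2 B (cross r b x) (cross r b z).
by rewrite disj cards0; have := dense_AB xA; have := dense_AB zA; lia.
Qed.

Lemma not_all_lines_small : A != set0 -> B != set0 -> False.
Proof.
move=> A0 B0.
have gp_freeA := dense_crosses_general_position_free dense_AB.
have gp_freeB := dense_crosses_general_position_free dense_BA.
have no_rowsA := small_lines_no_parallel_cover dense_BA small_r small_b.
have no_columnsA :=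
  small_lines_no_parallel_cover (dense_crossesC dense_BA) small_b small_r.
have no_rowsB := small_lines_no_parallel_cover dense_AB
  (small_linesC small_r) (small_linesC small_b).
have no_columnsB := small_lines_no_parallel_cover (dense_crossesC dense_AB)
  (small_linesC small_b) (small_linesC small_r).
case: (two_line_cover A0 gp_freeA) => [] [u1 [v1 coverA]].
- by rewrite (negPf (no_rowsA u1 v1)) in coverA.
- by rewrite (negPf (no_columnsA u1 v1)) in coverA.
case: (two_line_cover B0 gp_freeB) => [] [u2 [v2 coverB]].
- by rewrite (negPf (no_rowsB u2 v2)) in coverB.
- by rewrite (negPf (no_columnsB u2 v2)) in coverB.
by have := no_perpendicular_covers u2 v2 coverA; rewrite coverB.
Qed.

End NotAllLinesSmall.

Section MinDegree.

Variables (T : finType) (e : rel T) (A B : {set T}).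

Lemma min_degree_leq_degree x : x \in A -> min_degree e A B <= degree_in e B x.
Proof. by move=> xA; rewrite -leEnat; apply: bigmin_le_cond. Qed.

Lemma min_degree_leq_card : min_degree e A B <= #|B|.
Proof. by rewrite -leEnat; apply: bigmin_le_id. Qed.

Lemma min_degree_dense_crosses (I J : eqType) (r : T -> I) (b : T -> J) :
  (forall x y, e x y -> y \in cross r b x) ->
  2 * #|B| < 3 * min_degree e A B -> dense_crosses r b A B.
Proof.
move=> e_cross dense x xA; apply: leq_trans dense _; rewrite leq_mul2l /=.
apply: leq_trans (min_degree_leq_degree xA) _; apply/subset_leq_card/subsetP.
by move=> y; rewrite in_setI inE => /andP[-> /e_cross].
Qed.

End MinDegree.

Section MonochromaticComponents.

Variables (T : finType) (e : rel T) (k : nat) (c : {set T} -> 'I_k).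
Hypothesis e_sym : symmetric e.

Definition color_root (i : 'I_k) : T -> T := fingraph.root (color_rel e c i).

Lemma color_connect_sym i : connect_sym (color_rel e c i).
Proof.
by apply: sym_connect_sym => x y; rewrite /color_rel /= e_sym setUC.
Qed.

Lemma color_root_edge x y : e x y ->
  color_root (c [set x; y]) y = color_root (c [set x; y]) x.
Proof.
move=> exy; apply/eqP; rewrite eq_sym (root_connect (color_connect_sym _)).
by rewrite connect1 // /color_rel /= exy eqxx.
Qed.

Lemma edge_color_support x y :
  e x y -> x \in color_support e c (c [set x; y]).
Proof.
move=> exy; rewrite inE; apply/existsP; exists y.
by rewrite /color_rel /= exy eqxx.
Qed.

Lemma connect_neq_color_support i x y :
  connect (color_rel e c i) x y -> x != y -> x \in color_support e c i.
Proof.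
case/connectP=> [[|z p] /= e_p ->]; first by rewrite eqxx.
by move=> _; rewrite inE; apply/existsP; exists z; case/andP: e_p.
Qed.

Lemma color_root_line_component i x : x \in color_support e c i ->
  line (color_root i) (color_root i x) \in mono_components e c i.
Proof.
move=> xS; apply/imsetP; exists x => //; apply/setP=> y.
rewrite [LHS]in_set [RHS]in_set (root_connect (color_connect_sym i)).
rewrite [in RHS]color_connect_sym.
have [->|nyx] := eqVneq y x; first by rewrite connect0 xS.
case: (boolP (connect _ y x)) => [yx|_]; last by rewrite andbF.
by rewrite (connect_neq_color_support yx nyx).
Qed.

Lemma nontrivial_color_root_line_component i t :
  1 < #|line (color_root i) t| ->
  line (color_root i) t \in mono_components e c i.
Proof.
move=> /card_gt1P[x [y [+ + nxy]]]; rewrite !inE => /eqP <- /eqP yx.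
apply/color_root_line_component/(connect_neq_color_support _ nxy).
by rewrite -(root_connect (color_connect_sym i)) [fingraph.root _ y]yx.
Qed.

End MonochromaticComponents.

Section BipartiteTwoColored.

Variables (T : finType) (e : rel T) (X Y : {set T}) (c : {set T} -> 'I_2).
Hypotheses (graph_e : simple_graph e) (bip : bipartition e X Y).
Hypotheses (dense_XY : 2 * #|Y| < 3 * min_degree e X Y).
Hypotheses (dense_YX : 2 * #|X| < 3 * min_degree e Y X).

Let e_sym : symmetric e := proj1 graph_e.

Lemma edge_in_cross x y : e x y ->
  y \in cross (color_root e c ord0) (color_root e c ord_max) x.
Proof.
move=> exy; have := color_root_edge c e_sym exy; rewrite !inE.
have [->|->] : c [set x; y] = ord0 \/ c [set x; y] = ord_max.
  by case: (c _) => [[|[|//]] ?]; [left|right]; apply: val_inj.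
- by move=> ->; rewrite eqxx.
- by move=> ->; rewrite eqxx orbT.
Qed.

Lemma exists_large_color_root_line :
  exists i t, #|X| + #|Y| <= 2 * #|line (color_root e c i) t|.
Proof.
have [XY disjXY _] := bip.
have X0 : X != set0.
  by rewrite -card_gt0; have := min_degree_leq_card e Y X; lia.
have Y0 : Y != set0.
  by rewrite -card_gt0; have := min_degree_leq_card e X Y; lia.
pose f := color_root e c.
have [/existsP[[i t] large]|/existsPn no_large] :=
  boolP [exists it, #|X| + #|Y| <= 2 * #|line (f it.1) it.2|].
  by exists i, t.
have small i : small_lines (f i) X Y.
  move=> t; have := no_large (i, t); rewrite -ltnNge; congr (2 * _ < _).
  rewrite -cardsUI -setIUl XY setTI setIACA (disjoint_setI0 disjXY).
  by rewrite set0I cards0 addn0.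
have crosses_XY := min_degree_dense_crosses edge_in_cross dense_XY.
have crosses_YX := min_degree_dense_crosses edge_in_cross dense_YX.
by case: (not_all_lines_small crosses_XY crosses_YX (small _) (small _)).
Qed.

Lemma exists_edge : exists x y, e x y.
Proof.
have [x xX] : exists x, x \in X.
  by apply/card_gt0P; have := min_degree_leq_card e Y X; lia.
have /card_gt0P[y] : 0 < degree_in e Y x.
  by have := min_degree_leq_degree e Y xX; lia.
by rewrite inE => /andP[_ exy]; exists x, y.
Qed.

(* A line with at most one point need not be a component, but then there are at
   most two vertices in all and any component is large enough. *)
Lemma exists_large_mono_component :
  exists i, exists2 C, C \in mono_components e c i & #|X| + #|Y| <= 2 * #|C|.
Proof.
have [i [t large]] := exists_large_color_root_line.
have [trivial_line|] := leqP #|line (color_root e c i) t| 1; last first.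
  move/(nontrivial_color_root_line_component e_sym) => comp.
  by exists i, (line (color_root e c i) t).
have [x [y exy]] := exists_edge; set j := c [set x; y].
exists j, (line (color_root e c j) (color_root e c j x)).
  exact/color_root_line_component/edge_color_support.
suff : 0 < #|line (color_root e c j) (color_root e c j x)| by lia.
by apply/card_gt0P; exists x; rewrite inE.
Qed.

End BipartiteTwoColored.

Local Open Scope ring_scope.

Lemma two_thirds_ltr_nat (n d : nat) :
  (2 / 3 * n%:R < d%:R :> rat) = (2 * n < 3 * d)%N.
Proof. by rewrite -(ltr_nat rat) !natrM; apply/idP/idP; lra. Qed.

Lemma half_ler_nat (n d : nat) : (n%:R / 2 <= d%:R :> rat) = (n <= 2 * d)%N.
Proof. by rewrite -(ler_nat rat) natrM; apply/idP/idP; lra. Qed.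

Theorem theorem4 (T : finType) (e : rel T) (X Y : {set T}) (m n : nat)
    (he : simple_graph e) (hXY : bipartition e X Y)
    (hm : #|X| = m) (hn : #|Y| = n)
    (hdX : (2 / 3 * n%:R : rat) < (min_degree e X Y)%:R)
    (hdY : (2 / 3 * m%:R : rat) < (min_degree e Y X)%:R)
    (c : {set T} -> 'I_2) :
  exists i : 'I_2, exists2 C : {set T},
    C \in mono_components e c i & ((m + n)%:R / 2 : rat) <= #|C|%:R.
Proof.
move: hdX hdY; rewrite !two_thirds_ltr_nat -hm -hn => dense_XY dense_YX.
have [i [C compC large]] :=
  exists_large_mono_component c he hXY dense_XY dense_YX.
by exists i, C; rewrite // half_ler_nat.
Qed.
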